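(* Let $N=M=S^1$, let $\lambda:\mathbb{R}^+\to\mathbb{R}^+$ be smooth, and let $\varphi(x)=\frac12\big(\lambda(x)-x\lambda'(x)\big)$. If $$x\varphi'(x)+\frac{\varphi(x)^2}{\lambda(x)}\ge0\qquad\text{for all }x>0,$$ then the sectional curvature of $C^\infty(S^1,S^1\times\mathbb{R})$ in the metric $\langle\langle\cdot,\cdot\rangle\rangle$ is nonnegative in all sections; that is, $\langle\langle R(U,V)V,U\rangle\rangle_{(\eta,F)}\ge0$ for all tangent vectors $U,V$ at every $(\eta,F)$ with $\eta$ a diffeomorphism.
   Context: $M=S^1$ carries its standard Riemannian metric with length form $\mu=dx$, and $N=S^1$ carries a volume form $\nu$. All objects are $C^\infty$. For an (orientation-preserving) diffeomorphism $\eta:N\to M$, its density $\rho:M\to\mathbb{R}^+$ is defined by $(\rho\circ\eta)\,\eta^*\mu=\nu$. The configuration space $C^\infty(N,M\times\mathbb{R})=C^\infty(N,M)\times C^\infty(N,\mathbb{R})$ is treated formally as an infinite-dimensional manifold; at a point $(\eta,F)$ with $\eta$ a diffeomorphism, tangent vectors have the form $(u\circ\eta,f\circ\eta)$ with $u$ a vector field and $f$ a function on $M$. The (weak) Riemannian metric is $$\langle\langle(u\circ\eta,f\circ\eta),(v\circ\eta,g\circ\eta)\rangle\rangle_{(\eta,F)}=\int_{S^1}\big[\lambda(\rho)fg+\rho\,uv\big]\,dx .$$ $R$ is the Riemann curvature tensor of its Levi-Civita connection, with the sign convention that $\langle\langle R(U,V)V,U\rangle\rangle$ is the unnormalized sectional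 curvature (positive on round spheres). *)

(* Defs.v *)
From Stdlib Require Import Reals Lra ClassicalEpsilon.
From Coquelicot Require Import Coquelicot.
Open Scope R_scope.

(** Stdlib reals with Coquelicot.

    The circle is [R / 2 PI Z].  Functions on it are 2 PI-periodic functions on
    [R], and a map of degree one from the circle to itself is represented by a
    lift [eta : R -> R] with [eta (s + 2 PI) = eta s + 2 PI]; two lifts of the
    same map differ by a constant in [2 PI Z], which changes none of the notions
    below.  As the tangent bundle of the circle is trivial, the tangent space of
    the configuration space at [(eta, F)] is the space of all pairs of smooth
    periodic functions on N, and [(eta, F)] is itself a global affine
    coordinate. *)

Definition smooth (f : R -> R) : Prop :=
  forall (n : nat) (x : R), ex_derive_n f n x.

Definition smooth_on_pos (f : R -> R) : Prop :=
  forall (n : nat) (x : R), 0 < x -> ex_derive_n f n x.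

Definition periodic (f : R -> R) : Prop :=
  forall s : R, f (s + 2 * PI) = f s.

(** The volume form [nu = w ds] on N, in a positively oriented coordinate. *)
Definition volume_form (w : R -> R) : Prop :=
  smooth w /\ periodic w /\ forall s : R, 0 < w s.

Definition circle_lift (eta : R -> R) : Prop :=
  smooth eta /\ forall s : R, eta (s + 2 * PI) = eta s + 2 * PI.

(** A diffeomorphism with a lift of degree [+1] preserves the orientation. *)
Definition circle_diffeo (eta : R -> R) : Prop :=
  circle_lift eta /\
  exists xi : R -> R, circle_lift xi /\
    (forall s : R, xi (eta s) = s) /\ (forall x : R, eta (xi x) = x).

Definition inv_map (eta : R -> R) (x : R) : R :=
  epsilon (inhabits 0) (fun s : R => eta s = x).

Definition density (w eta : R -> R) (x : R) : R :=
  w (inv_map eta x) / Derive eta (inv_map eta x).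

Lemma inv_mapK (eta : R -> R) :
  circle_diffeo eta -> forall s : R, inv_map eta (eta s) = s.
Proof.
intros [_ [xi [_ [Hxi _]]]] s; unfold inv_map.
assert (H : eta (epsilon (inhabits 0) (fun r : R => eta r = eta s)) = eta s).
{ apply (epsilon_spec (inhabits 0) (fun r : R => eta r = eta s)).
  now exists s. }
apply (f_equal xi) in H; now rewrite !Hxi in H.
Qed.

Lemma Derive_circle_diffeo_neq0 (eta : R -> R) :
  circle_diffeo eta -> forall s : R, Derive eta s <> 0.
Proof.
intros [[Seta _] [xi [[Sxi _] [Hxi _]]]] s H0.
assert (H : Derive (fun r => xi (eta r)) s = Derive eta s * Derive xi (eta s)).
{ apply Derive_comp; [exact (Sxi 1%nat (eta s)) | exact (Seta 1%nat s)]. }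
rewrite (Derive_ext _ (fun r => r) s Hxi), Derive_id, H0 in H; lra.
Qed.

(** [(rho o eta) eta^* dx = nu]. *)
Lemma density_spec (w eta : R -> R) :
  circle_diffeo eta ->
  forall s : R, density w eta (eta s) * Derive eta s = w s.
Proof.
intros Heta s; unfold density; rewrite inv_mapK by assumption.
field; now apply Derive_circle_diffeo_neq0.
Qed.

(** The type of configurations [(eta, F)], of their tangent vectors
    [(u o eta, f o eta)] (as pairs of functions on N), and the vector space
    operations. *)
Definition pairfun : Type := ((R -> R) * (R -> R))%type.

Definition padd (U V : pairfun) : pairfun :=
  (fun s => fst U s + fst V s, fun s => snd U s + snd V s).
Definition pscal (t : R) (U : pairfun) : pairfun :=
  (fun s => t * fst U s, fun s => t * snd U s).
Definition psub (U V : pairfun) : pairfun := padd U (pscal (-1) V).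

Definition diffeo_config (p : pairfun) : Prop :=
  circle_diffeo (fst p) /\ smooth (snd p) /\ periodic (snd p).

Definition tangent (U : pairfun) : Prop :=
  (smooth (fst U) /\ periodic (fst U)) /\ (smooth (snd U) /\ periodic (snd U)).

Definition metric (lam w : R -> R) (p U V : pairfun) : R :=
  let eta := fst p in
  let rho := density w eta in
  let u x := fst U (inv_map eta x) in
  let f x := snd U (inv_map eta x) in
  let v x := fst V (inv_map eta x) in
  let g x := snd V (inv_map eta x) in
  RInt (fun x => lam (rho x) * f x * g x + rho x * u x * v x) 0 (2 * PI).

(** A vector field assigns a tangent vector to each configuration. *)
Definition vfield : Type := pairfun -> pairfun.

(** Derivative of [Y] at [p] in the direction [U] in the affine coordinate,
    computed pointwise on N; it is the value of the derivative in the smooth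
    topology whenever the latter exists. *)
Definition ddir (Y : vfield) (p U : pairfun) : pairfun :=
  (fun s => Derive (fun t => fst (Y (padd p (pscal t U))) s) 0,
   fun s => Derive (fun t => snd (Y (padd p (pscal t U))) s) 0).

(** A connection is given by its Christoffel map [G], where [G p] is bilinear
    on the tangent space at [p]. *)
Definition christoffel : Type := pairfun -> pairfun -> pairfun -> pairfun.

Definition nabla (G : christoffel) (X Y : vfield) : vfield :=
  fun p => padd (ddir Y p (X p)) (G p (X p) (Y p)).

Definition bracket (X Y : vfield) : vfield :=
  fun p => psub (ddir Y p (X p)) (ddir X p (Y p)).

Definition curvature_field (G : christoffel) (X Y Z : vfield) : vfield :=
  fun p =>
    psub (psub (nabla G X (nabla G Y Z) p) (nabla G Y (nabla G X Z) p))
         (nabla G (bracket X Y) Z p).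

(** [R(U,V)W] at [p], extending the tangent vectors to fields that are constant
    in the affine coordinate. *)
Definition curvature (G : christoffel) (p U V W : pairfun) : pairfun :=
  curvature_field G (fun _ => U) (fun _ => V) (fun _ => W) p.

Definition is_connection (G : christoffel) : Prop :=
  forall p : pairfun, diffeo_config p ->
    (forall U V, tangent U -> tangent V -> tangent (G p U V)) /\
    (forall (a : R) U U' V, tangent U -> tangent U' -> tangent V ->
       G p (padd (pscal a U) U') V = padd (pscal a (G p U V)) (G p U' V)) /\
    (forall (a : R) U V V', tangent U -> tangent V -> tangent V' ->
       G p U (padd (pscal a V) V') = padd (pscal a (G p U V)) (G p U V')) /\
    (forall U V W, tangent U -> tangent V -> tangent W -> forall s : R,
       ex_derive (fun t => fst (G (padd p (pscal t U)) V W) s) 0 /\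
       ex_derive (fun t => snd (G (padd p (pscal t U)) V W) s) 0).

(** The torsion is [G p U V - G p V U]. *)
Definition torsion_free (G : christoffel) : Prop :=
  forall p : pairfun, diffeo_config p ->
    forall U V, tangent U -> tangent V -> G p U V = G p V U.

(** [U <<V,W>> = <<nabla_U V, W>> + <<V, nabla_U W>>] on constant fields, which
    by the Leibniz rule gives it on all fields. *)
Definition metric_compatible (lam w : R -> R) (G : christoffel) : Prop :=
  forall p : pairfun, diffeo_config p ->
    forall U V W, tangent U -> tangent V -> tangent W ->
      is_derive (fun t => metric lam w (padd p (pscal t U)) V W) 0
        (metric lam w p (G p U V) W + metric lam w p V (G p U W)).

Definition is_levi_civita (lam w : R -> R) (G : christoffel) : Prop :=
  is_connection G /\ torsion_free G /\ metric_compatible lam w G.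

(** These conditions determine [G p U V] for every diffeomorphism configuration
    [p] and all tangent [U], [V], as the metric is nondegenerate there; the
    curvature at [p] depends on no other values of [G]. *)
Definition levi_civita (lam w : R -> R) : christoffel :=
  epsilon (inhabits (fun _ U _ => U)) (is_levi_civita lam w).

Definition riemann (lam w : R -> R) : pairfun -> pairfun -> pairfun -> pairfun -> pairfun :=
  curvature (levi_civita lam w).

Definition phi (lam : R -> R) (x : R) : R :=
  / 2 * (lam x - x * Derive lam x).

(* Main.v *)
(** Pulled back to N by [eta], the metric is [int (L f g + w u v) ds], where
    [L = lam(rho) a], [a = eta'] and [rho = w / a]; it depends on the configuration only
    through [a], and [dL/da = 2 q] with [q = phi(rho)].  Koszul's formula gives
    [Gamma((u,f),(v,g)) = ((q f g)' / w, q (u' g + v' f) / L)].  This exists as a smooth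
    map, so the epsilon in [levi_civita] is meaningful and agrees with it on
    diffeomorphisms, which are stable under small variations of [eta].  After
    integration by parts the sectional curvature becomes
    [int (q^2 / L - dq/da) (u' g - v' f)^2 + q^2 (f' g - f g')^2 / w ds], and
    [q^2 / L - dq/da = (phi(rho)^2 / lam(rho) + rho phi'(rho)) / a]. *)
Require Import Defs.
From Stdlib Require Import Reals ZArith Lra Lia ClassicalEpsilon.
From Stdlib Require Import FunctionalExtensionality.
From Coquelicot Require Import Coquelicot.
Open Scope R_scope.

(** * Closure properties of smooth functions *)

(** The metric is weak, so Koszul's formula prescribes only pairings and does not by itself produce
    a connection; the explicit map [gamma] is exhibited and verified instead. The value
    [levi_civita] is an epsilon, pinned down only at diffeomorphisms, yet curvature differentiates
    it in the configuration. Hence positivity of eta' must be shown stable along every line of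
    configurations: agreement with [gamma] near [t = 0] carries the derivative over. The shape of
    the result comes from Gauss's formula in an affine chart: <<R(U,V)V,U>> equals D_U D_V <<U,V>> -
    (D_U^2 <<V,V>> + D_V^2 <<U,U>>) / 2 plus |Gamma(U,V)|^2 - <<Gamma(U,U), Gamma(V,V)>>. As the
    metric depends on a alone, the part with second derivatives is the integral of -(dq/da) (u' g -
    v' f)^2. Each component of the quadratic part is a discriminant that collapses to a square. *)

Definition whole (x : R) : Prop := True.
Definition positive (x : R) : Prop := 0 < x.

Lemma open_whole : open whole.
Proof. exact open_true. Qed.

Lemma open_positive : open positive.
Proof. exact (open_gt 0). Qed.

(** Unlike [ex_derive_n], differentiates on the inside, so that closure properties
    follow from the rules for the first derivative by induction. *)
Fixpoint C_on (D : R -> Prop) (n : nat) (f : R -> R) : Prop :=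
  match n with
  | O => True
  | S n => (forall x, D x -> ex_derive f x) /\ C_on D n (Derive f)
  end.

(** Openness of [D] turns equality on [D] into equality near each of its points, which is what
    derivatives see. *)
Lemma C_on_ext (D : R -> Prop) (n : nat) (f g : R -> R) :
  open D -> (forall x, D x -> f x = g x) -> C_on D n f -> C_on D n g.
Proof.
intros oD; revert f g; induction n as [|n IH]; intros f g Hfg; [easy|].
assert (Hl : forall x, D x -> locally x (fun y => f y = g y)).
{ intros x Dx; apply (filter_imp D); [exact Hfg | exact (oD x Dx)]. }
intros [Hf Hf']; split.
- intros x Dx; apply (ex_derive_ext_loc f); auto.
- apply (IH (Derive f)); auto.
  intros x Dx; apply Derive_ext_loc; auto.
Qed.

Lemma C_on_S (D : R -> Prop) (n : nat) (f : R -> R) : C_on D (S n) f -> C_on D n f.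
Proof.
revert f; induction n as [|n IH]; intros f [Hf Hf']; split; auto.
Qed.

Lemma C_on_intro (D : R -> Prop) (n : nat) (f df : R -> R) :
  open D -> (forall x, D x -> is_derive f x (df x)) -> C_on D n df ->
  C_on D (S n) f.
Proof.
intros oD Hf Hdf; split.
- intros x Dx; eexists; eauto.
- apply (C_on_ext D n df); auto.
  intros x Dx; symmetry; apply is_derive_unique; auto.
Qed.

Lemma C_on_is_derive (D : R -> Prop) (n : nat) (f : R -> R) (x : R) :
  C_on D (S n) f -> D x -> is_derive f x (Derive f x).
Proof. intros [Hf _] Dx; apply Derive_correct; auto. Qed.

Lemma C_on_const (D : R -> Prop) (n : nat) (c : R) : open D -> C_on D n (fun _ => c).
Proof.
intros oD; revert c; induction n as [|n IH]; intros c; [easy|].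
apply (C_on_intro D n _ (fun _ => 0)); auto.
intros x _; auto_derive; auto.
Qed.

Lemma C_on_id (D : R -> Prop) (n : nat) : open D -> C_on D n (fun x => x).
Proof.
intros oD; destruct n as [|n]; [easy|].
apply (C_on_intro D n _ (fun _ => 1)); auto using C_on_const.
intros x _; auto_derive; auto.
Qed.

Lemma C_on_plus (D : R -> Prop) (n : nat) (f g : R -> R) : open D ->
  C_on D n f -> C_on D n g -> C_on D n (fun x => f x + g x).
Proof.
intros oD; revert f g; induction n as [|n IH]; intros f g Hf Hg; [easy|].
apply (C_on_intro D n _ (fun x => Derive f x + Derive g x)); auto.
- intros x Dx; apply (is_derive_plus (V := R_NormedModule)); apply (C_on_is_derive D n); auto.
- apply IH; [apply Hf | apply Hg].
Qed.

Lemma C_on_mult (D : R -> Prop) (n : nat) (f g : R -> R) : open D ->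
  C_on D n f -> C_on D n g -> C_on D n (fun x => f x * g x).
Proof.
intros oD; revert f g; induction n as [|n IH]; intros f g Hf Hg; [easy|].
apply (C_on_intro D n _ (fun x => Derive f x * g x + f x * Derive g x)); auto.
- intros x Dx; apply (is_derive_mult (K := R_AbsRing)); try (apply (C_on_is_derive D n); auto).
  intros; apply Rmult_comm.
- apply C_on_plus; auto; apply IH; [apply Hf | | | apply Hg]; now apply C_on_S.
Qed.

Lemma C_on_comp (D E : R -> Prop) (n : nat) (f g : R -> R) : open D -> open E ->
  (forall x, E x -> D (g x)) ->
  C_on D n f -> C_on E n g -> C_on E n (fun x => f (g x)).
Proof.
intros oD oE HED; revert f; induction n as [|n IH]; intros f Hf Hg; [easy|].
apply (C_on_intro E n _ (fun x => Derive g x * Derive f (g x))); auto.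
- intros x Dx; apply (is_derive_comp (V := R_NormedModule) f g).
  + apply (C_on_is_derive D n); auto.
  + apply (C_on_is_derive E n); auto.
- apply C_on_mult; auto; [apply Hg|].
  apply IH; [apply Hf | apply C_on_S; auto].
Qed.

Lemma C_on_inv (D : R -> Prop) (n : nat) (f : R -> R) : open D ->
  (forall x, D x -> f x <> 0) -> C_on D n f -> C_on D n (fun x => / f x).
Proof.
intros oD Hn0; revert f Hn0; induction n as [|n IH]; intros f Hn0 Hf; [easy|].
apply (C_on_intro D n _ (fun x => (-1) * Derive f x * (/ f x * / f x))); auto.
- intros x Dx.
  replace (-1 * Derive f x * (/ f x * / f x)) with (- Derive f x / f x ^ 2)
    by (field; auto).
  apply is_derive_inv; auto; apply (C_on_is_derive D n); auto.
- repeat apply C_on_mult; auto using C_on_const, C_on_S; apply Hf.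
Qed.

Lemma C_on_ex_derive_n (D : R -> Prop) (f : R -> R) :
  (forall n x, D x -> ex_derive_n f n x) <-> (forall n, C_on D n f).
Proof.
(* The case [n = 0] is separate: the left side is then differentiability of [f], whereas
   [ex_derive_n _ 0] is [True]. *)
assert (HD : forall (f : R -> R) n, ex_derive_n f (S n) = ex_derive_n (Derive f) n \/ n = O).
{ intros h [|n]; [now right | left].
  apply functional_extensionality; intros x; simpl.
  f_equal; apply functional_extensionality; intros y.
  transitivity (Derive_n h (S n) y); [reflexivity|].
  rewrite <- (Nat.add_1_r n), <- Derive_n_comp; reflexivity. }
split.
- intros Hf n; revert f Hf; induction n as [|n IH]; intros f Hf; [easy|].
  split; [intros x Dx; exact (Hf 1%nat x Dx)|].
  apply IH; intros [|k] x Dx; [easy|].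
  destruct (HD f (S k)) as [<-|]; [auto | easy].
- intros Hf n; revert f Hf; induction n as [|n IH]; intros f Hf x Dx; [easy|].
  destruct (HD f n) as [->| ->].
  + apply IH; auto; intros k; apply (Hf (S k)).
  + apply (Hf 1%nat); auto.
Qed.

Lemma smooth_C (f : R -> R) : smooth f <-> forall n, C_on whole n f.
Proof.
rewrite <- C_on_ex_derive_n; split; intros H n x; [intros _|]; auto; now apply H.
Qed.

Lemma smooth_on_pos_C (f : R -> R) : smooth_on_pos f <-> forall n, C_on positive n f.
Proof. rewrite <- C_on_ex_derive_n; reflexivity. Qed.

Lemma smooth_const (c : R) : smooth (fun _ => c).
Proof. apply smooth_C; auto using C_on_const, open_whole. Qed.

Lemma smooth_plus (f g : R -> R) : smooth f -> smooth g -> smooth (fun x => f x + g x).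
Proof. rewrite !smooth_C; auto using C_on_plus, open_whole. Qed.

Lemma smooth_mult (f g : R -> R) : smooth f -> smooth g -> smooth (fun x => f x * g x).
Proof. rewrite !smooth_C; auto using C_on_mult, open_whole. Qed.

Lemma smooth_opp (f : R -> R) : smooth f -> smooth (fun x => - f x).
Proof.
intros Hf; replace (fun x => - f x) with (fun x => -1 * f x).
- now apply smooth_mult; [apply smooth_const|].
- apply functional_extensionality; intros; ring.
Qed.

Lemma smooth_minus (f g : R -> R) : smooth f -> smooth g -> smooth (fun x => f x - g x).
Proof. intros; now apply smooth_plus, smooth_opp. Qed.

Lemma smooth_div (f g : R -> R) : smooth f -> smooth g -> (forall x, 0 < g x) ->
  smooth (fun x => f x / g x).
Proof.
intros Hf Hg Hpos; apply smooth_mult; auto.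
rewrite !smooth_C in *; intros n; apply C_on_inv; auto using open_whole.
intros x _; specialize (Hpos x); lra.
Qed.

Lemma smooth_comp (f g : R -> R) : smooth f -> smooth g -> smooth (fun x => f (g x)).
Proof.
rewrite !smooth_C; intros; now apply (C_on_comp whole whole); auto using open_whole.
Qed.

Lemma smooth_comp_pos (f g : R -> R) : smooth_on_pos f -> smooth g -> (forall x, 0 < g x) ->
  smooth (fun x => f (g x)).
Proof.
rewrite smooth_on_pos_C, !smooth_C; intros.
apply (C_on_comp positive whole); auto using open_whole, open_positive.
intros; red; auto.
Qed.

Lemma smooth_Derive (f : R -> R) : smooth f -> smooth (Derive f).
Proof. rewrite !smooth_C; intros Hf n; apply (Hf (S n)). Qed.

Lemma smooth_on_pos_Derive (f : R -> R) : smooth_on_pos f -> smooth_on_pos (Derive f).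
Proof. rewrite !smooth_on_pos_C; intros Hf n; apply (Hf (S n)). Qed.

Lemma smooth_on_pos_phi (lam : R -> R) : smooth_on_pos lam -> smooth_on_pos (phi lam).
Proof.
intros Hl; pose proof (smooth_on_pos_Derive lam Hl) as Hl'.
rewrite smooth_on_pos_C in *; intros n.
apply (C_on_ext positive n (fun x => / 2 * (lam x + (-1) * (x * Derive lam x)))).
- exact open_positive.
- intros x _; unfold phi; ring.
- repeat first [apply C_on_mult | apply C_on_plus | apply C_on_const | apply C_on_id
    | apply open_positive | apply Hl | apply Hl'].
Qed.

Lemma smooth_ex_derive (f : R -> R) (x : R) : smooth f -> ex_derive f x.
Proof. intros Hf; exact (Hf 1%nat x). Qed.

Lemma smooth_continuous (f : R -> R) (x : R) : smooth f -> continuous f x.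
Proof.
intros Hf; apply (ex_derive_continuous (V := R_NormedModule)).
now apply smooth_ex_derive.
Qed.

Lemma smooth_on_pos_ex_derive (f : R -> R) (x : R) : smooth_on_pos f -> 0 < x -> ex_derive f x.
Proof. intros Hf; exact (Hf 1%nat x). Qed.

(** * Diffeomorphisms of the circle *)

Lemma periodic_IZR (f : R -> R) (k : Z) (s : R) :
  periodic f -> f (s + IZR k * (2 * PI)) = f s.
Proof.
intros Hf.
assert (Hn : forall (n : nat) r, f (r + INR n * (2 * PI)) = f r).
{ induction n as [|n IH]; intros r.
  - f_equal; simpl; ring.
  - rewrite S_INR; replace (r + (INR n + 1) * (2 * PI)) with ((r + INR n * (2 * PI)) + 2 * PI) by ring.
    now rewrite Hf. }
destruct (Z_le_gt_dec 0 k) as [Hk|Hk].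
- rewrite <- (Z2Nat.id k), <- INR_IZR_INZ by assumption; apply Hn.
- rewrite <- (Hn (Z.to_nat (- k)) (s + _)); f_equal.
  rewrite INR_IZR_INZ, Z2Nat.id, opp_IZR by lia; ring.
Qed.

Lemma periodic_reduce (f : R -> R) (s : R) :
  periodic f -> exists r, 0 <= r <= 2 * PI /\ f s = f r.
Proof.
intros Hf; pose proof PI_RGT_0 as HPI.
exists (s + IZR (- Int_part (s / (2 * PI))) * (2 * PI)); split.
- rewrite opp_IZR; destruct (base_Int_part (s / (2 * PI))) as [H1 H2].
  assert (Hs : s = s / (2 * PI) * (2 * PI)) by (field; lra).
  set (k := IZR (Int_part (s / (2 * PI)))) in *; set (t := s / (2 * PI)) in *.
  rewrite Hs; nra.
- symmetry; now apply periodic_IZR.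
Qed.

Lemma periodic_bounded (f : R -> R) : periodic f -> (forall s, continuous f s) ->
  exists M, forall s, f s <= M.
Proof.
intros Hf Cf; pose proof PI_RGT_0.
destruct (continuity_ab_maj f 0 (2 * PI)) as [m [Hm _]]; [lra| |].
- intros c _; apply continuity_pt_filterlim, Cf.
- exists (f m); intros s.
  destruct (periodic_reduce f s Hf) as [r [Hr ->]]; auto.
Qed.

Lemma Derive_shift (f : R -> R) (c s : R) : Derive (fun x => f (x + c)) s = Derive f (s + c).
Proof.
unfold Derive; f_equal; apply Lim_ext; intros h.
now replace (s + h + c) with (s + c + h) by ring.
Qed.

Lemma periodic_Derive (f : R -> R) : periodic f -> periodic (Derive f).
Proof. intros Hf s; rewrite <- Derive_shift; now apply Derive_ext. Qed.

Lemma periodic_Derive_lift (eta : R -> R) : circle_lift eta -> periodic (Derive eta).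
Proof.
intros [Seta Heta] s.
rewrite <- Derive_shift, (Derive_ext _ (fun x => eta x + 2 * PI) s Heta).
rewrite Derive_plus, Derive_const.
- ring.
- now apply smooth_ex_derive.
- apply ex_derive_const.
Qed.

(** Over one period a lift gains exactly one turn, so the mean value theorem yields a point of slope
    1. A nonpositive slope elsewhere would force a zero of the derivative in between, which
    invertibility excludes. *)
Lemma circle_diffeo_Derive_pos (eta : R -> R) : circle_diffeo eta ->
  forall s, 0 < Derive eta s.
Proof.
intros Heta s; pose proof PI_RGT_0 as HPI.
pose proof (Derive_circle_diffeo_neq0 eta Heta) as Hn0.
destruct Heta as [[Seta Peta] _].
destruct (MVT_gen eta 0 (0 + 2 * PI) (Derive eta)) as [c [_ Hc]].
{ intros x _; now apply Derive_correct, smooth_ex_derive. }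
{ intros x _; now apply continuity_pt_filterlim, smooth_continuous. }
assert (Dc : Derive eta c = 1) by (rewrite Peta in Hc; nra).
destruct (Rlt_or_le 0 (Derive eta s)) as [|Hs]; [easy|exfalso].
destruct (IVT_gen (Derive eta) s c 0) as [z [_ Hz]].
- intros x; now apply continuity_pt_filterlim, smooth_continuous, smooth_Derive.
- rewrite Dc, Rmin_left, Rmax_right; lra.
- now apply (Hn0 z).
Qed.

Lemma lift_IZR (eta : R -> R) (k : Z) (s : R) : circle_lift eta ->
  eta (s + IZR k * (2 * PI)) = eta s + IZR k * (2 * PI).
Proof.
intros [_ Heta].
assert (H : periodic (fun r => eta r - r)) by (intros r; rewrite Heta; ring).
pose proof (periodic_IZR _ k s H); simpl in *; lra.
Qed.

Lemma lift_surjective (eta : R -> R) (x : R) : circle_lift eta -> exists s, eta s = x.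
Proof.
intros Heta; pose proof PI_RGT_0 as HPI.
(* [k] counts the whole turns from [eta 0] to [x], so [x] lies between the values of [eta] at [k]
   and [k + 1] periods. *)
set (k := Int_part ((x - eta 0) / (2 * PI))).
destruct (base_Int_part ((x - eta 0) / (2 * PI))) as [H1 H2]; fold k in H1, H2.
assert (Hs : x - eta 0 = (x - eta 0) / (2 * PI) * (2 * PI)) by (field; lra).
set (t := (x - eta 0) / (2 * PI)) in *.
destruct (IVT_gen eta (0 + IZR k * (2 * PI)) (0 + IZR (k + 1) * (2 * PI)) x) as [s [_ Es]].
- intros y; apply continuity_pt_filterlim, smooth_continuous, Heta.
- rewrite !lift_IZR, plus_IZR by assumption.
  rewrite Rmin_left, Rmax_right by nra; nra.
- now exists s.
Qed.

Lemma increasing_of_Derive_pos (f : R -> R) : smooth f -> (forall s, 0 < Derive f s) ->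
  forall x y, x < y -> f x < f y.
Proof.
intros Sf Hpos x y Hxy.
destruct (MVT_gen f x y (Derive f)) as [c [_ Hc]].
{ intros z _; now apply Derive_correct, smooth_ex_derive. }
{ intros z _; now apply continuity_pt_filterlim, smooth_continuous. }
specialize (Hpos c); nra.
Qed.

Lemma is_derive_inverse (f g : R -> R) : smooth f -> (forall s, 0 < Derive f s) ->
  (forall s, g (f s) = s) -> (forall x, f (g x) = x) ->
  forall x, is_derive g x (/ Derive f (g x)).
Proof.
intros Sf Hpos gf fg x.
pose proof (increasing_of_Derive_pos f Sf Hpos) as Hinc.
assert (Ginc : forall y z, y < z -> g y < g z).
{ intros y z Hyz; destruct (Rlt_or_le (g y) (g z)) as [|[H|H]]; [easy| |].
  - apply Hinc in H; rewrite !fg in H; lra.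
  - apply (f_equal f) in H; rewrite !fg in H; lra. }
assert (Gle : forall y z, y <= z -> g y <= g z).
{ intros y z [H| ->]; [apply Rlt_le; auto | lra]. }
(* The interval forms of the inverse function theorem need a window around [x]. The choice
   [x - 1, x + 1] corresponds to [g (x - 1), g (x + 1)] in the domain of [f]. *)
assert (Cg : continuity_pt g x).
{ apply (Ranalysis5.continuity_pt_recip_interv f g (g (x - 1)) (g (x + 1))).
  - apply Ginc; lra.
  - intros; auto.
  - intros y _ _; apply fg.
  - intros y H1 H2; rewrite fg in *; auto.
  - intros a _; now apply continuity_pt_filterlim, smooth_continuous.
  - rewrite !fg; lra. }
assert (Prf : forall a, g (x - 1) <= a <= g (x + 1) -> derivable_pt f a).
{ intros a _; now apply ex_derive_Reals_0, smooth_ex_derive. }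
assert (Prg : g (x - 1) <= g x <= g (x + 1)) by (split; apply Gle; lra).
apply is_derive_Reals.
replace (/ Derive f (g x)) with (1 / derive_pt f (g x) (Prf (g x) Prg)).
- apply Ranalysis5.derivable_pt_lim_recip_interv; auto; try lra.
  + intros y _; apply fg.
  + rewrite Derive_Reals; specialize (Hpos (g x)); lra.
- rewrite Derive_Reals; field; specialize (Hpos (g x)); lra.
Qed.

(** Bootstrapping: g' = 1 / f'(g), so each order of regularity of [g] yields the next. *)
Lemma smooth_inverse (f g : R -> R) : smooth f -> (forall s, 0 < Derive f s) ->
  (forall s, g (f s) = s) -> (forall x, f (g x) = x) -> smooth g.
Proof.
intros Sf Hpos gf fg.
pose proof (is_derive_inverse f g Sf Hpos gf fg) as Hg.
pose proof (smooth_Derive f Sf) as Sf'.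
rewrite smooth_C in *; induction n as [|n IH]; [easy|].
apply (C_on_intro whole n _ (fun x => / Derive f (g x))); auto using open_whole.
apply (C_on_inv whole); auto using open_whole.
- intros x _; specialize (Hpos (g x)); lra.
- apply (C_on_comp whole whole); auto using open_whole; intros; exact I.
Qed.

(** With the converse above, being a diffeomorphism becomes a sign condition on the derivative,
    which a small perturbation preserves. *)
Lemma circle_diffeo_of_Derive_pos (eta : R -> R) : circle_lift eta ->
  (forall s, 0 < Derive eta s) -> circle_diffeo eta.
Proof.
intros Leta Hpos; split; auto.
pose (inv x := constructive_indefinite_description _ (lift_surjective eta x Leta)).
pose (xi x := proj1_sig (inv x)).
assert (Hxi : forall x, eta (xi x) = x) by (intros x; exact (proj2_sig (inv x))).
pose proof (increasing_of_Derive_pos eta (proj1 Leta) Hpos) as Hinc.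
assert (Hinj : forall r s, eta r = eta s -> r = s).
{ intros r s H; destruct (Rtotal_order r s) as [Hl|[|Hl]]; auto;
    apply Hinc in Hl; lra. }
assert (Hxi' : forall s, xi (eta s) = s) by (intros s; apply Hinj, Hxi).
exists xi; repeat split; auto.
- apply (smooth_inverse eta); auto; apply Leta.
- intros x; apply Hinj; rewrite (proj2 Leta), !Hxi; ring.
Qed.

Lemma Derive_line (a b : R -> R) (t s : R) : smooth a -> smooth b ->
  Derive (fun r => a r + t * b r) s = Derive a s + t * Derive b s.
Proof.
intros; rewrite Derive_plus, Derive_scal; auto using smooth_ex_derive.
now apply ex_derive_scal, smooth_ex_derive.
Qed.

(** The perturbed slope is eta' + t u' = eta' (1 + t h) with h = u' / eta'. By periodicity h is
    bounded, so one bound on |t| serves all points of the circle. *)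
Lemma diffeo_config_line (p U : pairfun) : diffeo_config p -> tangent U ->
  locally 0 (fun t => diffeo_config (padd p (pscal t U))).
Proof.
intros [Heta [SF PF]] [[Su Pu] [Sf Pf]].
pose proof (circle_diffeo_Derive_pos _ Heta) as Hpos.
pose proof (proj1 Heta) as Leta.
set (h := fun s => Derive (fst U) s / Derive (fst p) s).
assert (Sh : smooth (fun s => h s * h s)).
{ apply smooth_mult; apply smooth_div; auto; apply smooth_Derive; auto; apply Leta. }
(* [periodic_bounded] bounds only from above, so it is applied to the square; |h| <= 1 + h^2 then
   gives the radius 1 / (1 + M). *)
destruct (periodic_bounded (fun s => h s * h s)) as [M HM].
{ intros s; unfold h; rewrite (periodic_Derive_lift _ Leta), (periodic_Derive _ Pu); auto. }
{ intros s; now apply smooth_continuous. }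
assert (HM0 : 0 <= M) by (apply Rle_trans with (2 := HM 0); nra).
assert (Hd : 0 < / (1 + M)) by (apply Rinv_0_lt_compat; lra).
exists (mkposreal _ Hd); intros t Ht.
assert (Ht' : Rabs t < / (1 + M)).
{ revert Ht; unfold ball; simpl; unfold AbsRing_ball, abs, minus, plus, opp; simpl.
  now rewrite Ropp_0, Rplus_0_r. }
unfold diffeo_config; simpl; split; [|split].
2: { apply smooth_plus; [auto|apply smooth_mult; auto using smooth_const]. }
2: { intros s; now rewrite PF, Pf. }
apply circle_diffeo_of_Derive_pos.
- split.
  + apply smooth_plus; [apply Leta | apply smooth_mult; auto using smooth_const].
  + intros s; rewrite (proj2 Leta), Pu; ring.
- intros s; rewrite Derive_line by (auto; apply Leta).
  specialize (Hpos s); specialize (HM s).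
  replace (Derive (fst U) s) with (h s * Derive (fst p) s) by (unfold h; field; lra).
  assert (Hth : -1 < t * h s).
  { apply Rabs_def2 in Ht'; destruct Ht' as [H1 H2].
    assert (Hu : / (1 + M) * (1 + M) = 1) by (field; lra).
    set (d := / (1 + M)) in *.
    assert (Rabs (t * h s) < 1).
    { rewrite Rabs_mult.
      assert (Rabs t < d) by (apply Rabs_def1; lra).
      assert (Rabs (h s) <= 1 + M).
      { pose proof (Rabs_pos (h s)); assert (Rabs (h s) * Rabs (h s) = h s * h s)
          by (rewrite <- Rabs_mult; apply Rabs_pos_eq; nra).
        nra. }
      pose proof (Rabs_pos t); pose proof (Rabs_pos (h s)); nra. }
    apply Rabs_def2 in H; lra. }
  nra.
Qed.

Ltac smooth_step :=
  match goal with
  | |- smooth (fun x => @?f x + @?g x) => apply (smooth_plus f g)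
  | |- smooth (fun x => @?f x * @?g x) => apply (smooth_mult f g)
  | |- smooth _ => assumption
  end.

(** * Integration over the circle *)

Definition loop (f : R -> R) : Prop := smooth f /\ periodic f.

Lemma loop_plus (f g : R -> R) : loop f -> loop g -> loop (fun s => f s + g s).
Proof.
intros [Sf Pf] [Sg Pg]; split; [now apply smooth_plus | intros s; now rewrite Pf, Pg].
Qed.

Lemma loop_minus (f g : R -> R) : loop f -> loop g -> loop (fun s => f s - g s).
Proof.
intros [Sf Pf] [Sg Pg]; split; [now apply smooth_minus | intros s; now rewrite Pf, Pg].
Qed.

Lemma loop_mult (f g : R -> R) : loop f -> loop g -> loop (fun s => f s * g s).
Proof.
intros [Sf Pf] [Sg Pg]; split; [now apply smooth_mult | intros s; now rewrite Pf, Pg].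
Qed.

Lemma loop_const (c : R) : loop (fun _ => c).
Proof. split; [apply smooth_const | easy]. Qed.

Lemma loop_div (f g : R -> R) : loop f -> loop g -> (forall s, 0 < g s) ->
  loop (fun s => f s / g s).
Proof.
intros [Sf Pf] [Sg Pg] Hg; split; [now apply smooth_div | intros s; now rewrite Pf, Pg].
Qed.

Lemma loop_Derive (f : R -> R) : loop f -> loop (Derive f).
Proof. intros [Sf Pf]; split; [now apply smooth_Derive | now apply periodic_Derive]. Qed.

Lemma loop_comp_pos (f g : R -> R) : smooth_on_pos f -> loop g -> (forall s, 0 < g s) ->
  loop (fun s => f (g s)).
Proof.
intros Sf [Sg Pg] Hg; split; [now apply smooth_comp_pos | intros s; now rewrite Pg].
Qed.

Lemma loop_continuous (f : R -> R) (s : R) : loop f -> continuous f s.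
Proof. intros [Sf _]; now apply smooth_continuous. Qed.

Lemma loop_ex_RInt (f : R -> R) (a b : R) : loop f -> ex_RInt f a b.
Proof.
intros Lf; apply (ex_RInt_continuous (V := R_CompleteNormedModule)).
intros; now apply loop_continuous.
Qed.

Ltac loop_step :=
  match goal with
  | H : loop ?f |- loop ?f => exact H
  | |- loop (fun _ => ?c) => apply (loop_const c)
  | |- loop (fun x => @?f x + @?g x) => apply (loop_plus f g)
  | |- loop (fun x => @?f x - @?g x) => apply (loop_minus f g)
  | |- loop (fun x => @?f x * @?g x) => apply (loop_mult f g)
  | |- loop (fun x => @?f x / @?g x) => apply (loop_div f g)
  | |- loop (Derive ?f) => apply (loop_Derive f)
  | |- loop (fun x => Derive ?f x) => apply (loop_Derive f)
  | |- loop _ => assumption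
  end.

Definition circle_int (f : R -> R) : R := RInt f 0 (2 * PI).

Lemma circle_int_ext (f g : R -> R) : (forall s, f s = g s) -> circle_int f = circle_int g.
Proof. intros H; now apply RInt_ext. Qed.

Lemma circle_int_plus (f g : R -> R) : loop f -> loop g ->
  circle_int (fun s => f s + g s) = circle_int f + circle_int g.
Proof. intros; apply (RInt_plus (V := R_CompleteNormedModule)); now apply loop_ex_RInt. Qed.

Lemma circle_int_minus (f g : R -> R) : loop f -> loop g ->
  circle_int (fun s => f s - g s) = circle_int f - circle_int g.
Proof. intros; apply (RInt_minus (V := R_CompleteNormedModule)); now apply loop_ex_RInt. Qed.

Lemma circle_int_Derive (f : R -> R) : loop f -> circle_int (Derive f) = 0.
Proof.
intros Lf; unfold circle_int; rewrite RInt_Derive.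
- rewrite <- (Rplus_0_l (2 * PI)), (proj2 Lf); ring.
- intros; now apply smooth_ex_derive, Lf.
- intros; now apply loop_continuous, loop_Derive.
Qed.

Lemma circle_int_ge0 (f : R -> R) : loop f -> (forall s, 0 <= f s) -> 0 <= circle_int f.
Proof.
intros Lf Hf; pose proof PI_RGT_0.
replace 0 with (circle_int (fun _ => 0)).
- apply RInt_le; try (apply loop_ex_RInt; auto using loop_const); auto; lra.
- unfold circle_int; rewrite RInt_const; apply Rmult_0_r.
Qed.

(** A lift need not fix 0, so substituting it moves the interval of integration to an arbitrary
    starting point. *)
Lemma loop_int_shift (f : R -> R) (a : R) : loop f ->
  RInt f a (a + 2 * PI) = circle_int f.
Proof.
intros Lf; unfold circle_int.
rewrite <- (RInt_Chasles f a 0 (a + 2 * PI)), <- (RInt_Chasles f 0 (2 * PI) (a + 2 * PI))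
  by now apply loop_ex_RInt.
assert (H : RInt f (2 * PI) (a + 2 * PI) = RInt f 0 a).
{ replace (2 * PI) with (1 * 0 + 2 * PI) at 1 by ring.
  replace (a + 2 * PI) with (1 * a + 2 * PI) by ring.
  rewrite <- (RInt_comp_lin f) by now apply loop_ex_RInt.
  apply RInt_ext; intros x _; unfold scal; simpl; unfold mult; simpl.
  rewrite !Rmult_1_l; apply (proj2 Lf). }
rewrite H, <- (opp_RInt_swap f 0 a) by now apply loop_ex_RInt.
unfold plus, opp; simpl; ring.
Qed.

(** Starting the period at the point [s] where [f] would be positive avoids any case distinction at
    the ends of [0, 2 PI]. *)
Lemma circle_int_definite (f : R -> R) : loop f -> (forall s, 0 <= f s) ->
  circle_int f = 0 -> forall s, f s = 0.
Proof.
intros Lf Hf H0 s; pose proof PI_RGT_0.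
destruct (Rle_lt_or_eq_dec 0 (f s) (Hf s)) as [Hs|]; [exfalso|auto].
destruct (loop_continuous f s Lf (fun y => 0 < y)) as [d Hd].
{ now apply open_gt. }
(* Half of [d] keeps [s, s + e] strictly inside the ball where [f] is positive; [PI] keeps it inside
   one period. *)
set (e := Rmin (d / 2) PI).
pose proof (cond_pos d) as Hd0.
assert (He : 0 < e <= PI) by (unfold e; split; [apply Rmin_pos; lra | apply Rmin_r]).
assert (Hed : e < d) by (apply Rle_lt_trans with (d / 2); [apply Rmin_l | lra]).
rewrite <- (loop_int_shift f s), <- (RInt_Chasles f s (s + e) (s + 2 * PI)) in H0
  by now (try apply loop_ex_RInt).
assert (H1 : 0 < RInt f s (s + e)).
{ apply RInt_gt_0; [lra | | intros; now apply loop_continuous].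
  intros x Hx; apply Hd; unfold ball; simpl; unfold AbsRing_ball, abs, minus, plus, opp; simpl.
  apply Rabs_def1; lra. }
assert (H2 : 0 <= RInt f (s + e) (s + 2 * PI)).
{ apply RInt_ge_0; [lra | now apply loop_ex_RInt | auto]. }
unfold plus in H0; simpl in H0; lra.
Qed.

Lemma circle_int_change_of_variable (eta h k : R -> R) : circle_diffeo eta ->
  smooth h -> loop k -> (forall s, Derive eta s * h (eta s) = k s) ->
  circle_int h = circle_int k.
Proof.
intros Heta Sh Lk Hk.
destruct (lift_surjective eta 0 (proj1 Heta)) as [a Ha].
destruct Heta as [[Seta Peta] _].
rewrite <- (loop_int_shift k a) by assumption.
rewrite <- (RInt_ext _ _ _ _ (fun s _ => Hk s)).
(* With [eta a = 0], the interval [0, 2 PI] on M is the image of [a, a + 2 PI] on N. *)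
symmetry; unfold circle_int; rewrite <- Ha at 1.
replace (2 * PI) with (eta (a + 2 * PI)) at 2 by (rewrite Peta, Ha; ring).
apply (RInt_comp (V := R_CompleteNormedModule)).
- intros; now apply smooth_continuous.
- intros; split; [now apply Derive_correct, smooth_ex_derive|].
  now apply smooth_continuous, smooth_Derive.
Qed.

Lemma smooth_inv_map (eta : R -> R) : circle_diffeo eta -> smooth (inv_map eta).
Proof.
intros Heta; pose proof (inv_mapK eta Heta) as HK.
destruct Heta as [_ [xi [[Sxi _] [_ Hxi]]]].
replace (inv_map eta) with xi; auto.
apply functional_extensionality; intros x.
rewrite <- (Hxi x) at 2; now rewrite HK.
Qed.

Lemma tangent_padd (U V : pairfun) : tangent U -> tangent V -> tangent (padd U V).
Proof. intros [? ?] [? ?]; split; now apply loop_plus. Qed.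

Lemma tangent_pscal (t : R) (U : pairfun) : tangent U -> tangent (pscal t U).
Proof. intros [? ?]; split; apply loop_mult; auto using loop_const. Qed.

Lemma tangent_psub (U V : pairfun) : tangent U -> tangent V -> tangent (psub U V).
Proof. intros; now apply tangent_padd, tangent_pscal. Qed.

(** * The metric pulled back to N, and uniqueness of its Levi-Civita connection *)

Section Metric.

Context (lam w : R -> R).
Context (lam_smooth : smooth_on_pos lam) (lam_pos : forall x, 0 < x -> 0 < lam x).
Context (Hw : volume_form w).

(** The functions [rho o eta], [L] and [q] on N. *)
Definition rad (p : pairfun) (s : R) : R := w s / Derive (fst p) s.
Definition wgt (p : pairfun) (s : R) : R := lam (rad p s) * Derive (fst p) s.
Definition phir (p : pairfun) (s : R) : R := phi lam (rad p s).

Lemma loop_w : loop w.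
Proof. split; apply Hw. Qed.

Lemma w_pos (s : R) : 0 < w s.
Proof. apply Hw. Qed.

Section At_configuration.

Context (p : pairfun) (Hp : diffeo_config p).

Lemma Deta_pos (s : R) : 0 < Derive (fst p) s.
Proof. now apply circle_diffeo_Derive_pos, Hp. Qed.

Lemma loop_Deta : loop (Derive (fst p)).
Proof.
split; [apply smooth_Derive; apply Hp | apply periodic_Derive_lift; apply Hp].
Qed.

Lemma rad_pos (s : R) : 0 < rad p s.
Proof. apply Rdiv_lt_0_compat; [apply w_pos | apply Deta_pos]. Qed.

Lemma loop_rad : loop (rad p).
Proof. apply loop_div; [apply loop_w | apply loop_Deta | apply Deta_pos]. Qed.

Lemma wgt_pos (s : R) : 0 < wgt p s.
Proof. apply Rmult_lt_0_compat; [apply lam_pos, rad_pos | apply Deta_pos]. Qed.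

Lemma loop_wgt : loop (wgt p).
Proof.
apply loop_mult; [|apply loop_Deta].
apply loop_comp_pos; [assumption | apply loop_rad | apply rad_pos].
Qed.

Lemma loop_phir : loop (phir p).
Proof.
apply (loop_comp_pos (phi lam) (rad p)); [|apply loop_rad | apply rad_pos].
now apply smooth_on_pos_phi.
Qed.

Lemma metric_pullback (U V : pairfun) : tangent U -> tangent V ->
  metric lam w p U V =
  circle_int (fun s => wgt p s * snd U s * snd V s + w s * fst U s * fst V s).
Proof.
intros [Lu Lf] [Lv Lg].
pose proof (proj1 Hp) as Heta.
pose proof (smooth_inv_map _ Heta) as Sxi.
apply (circle_int_change_of_variable (fst p)); auto.
- assert (Sr : smooth (density w (fst p))) by apply (smooth_comp _ _ (proj1 loop_rad) Sxi).
  assert (Sl : smooth (fun x => lam (density w (fst p) x))).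
  { apply smooth_comp_pos; auto; intros x; apply (rad_pos (inv_map (fst p) x)). }
  assert (SN : forall f, loop f -> smooth (fun x => f (inv_map (fst p) x))).
  { intros f Lh; exact (smooth_comp _ _ (proj1 Lh) Sxi). }
  pose proof (SN _ Lu); pose proof (SN _ Lf); pose proof (SN _ Lv); pose proof (SN _ Lg).
  repeat smooth_step.
- pose proof loop_w; pose proof loop_wgt; repeat loop_step.
- intros s; unfold wgt, rad, density; rewrite (inv_mapK _ Heta).
  pose proof (Deta_pos s); field; lra.
Qed.

Lemma metric_sym (U V : pairfun) : tangent U -> tangent V ->
  metric lam w p U V = metric lam w p V U.
Proof.
intros; rewrite !metric_pullback by assumption; apply circle_int_ext; intros; ring.
Qed.

Lemma loop_metric_integrand (U V : pairfun) : tangent U -> tangent V ->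
  loop (fun s => wgt p s * snd U s * snd V s + w s * fst U s * fst V s).
Proof.
intros [? ?] [? ?].
pose proof loop_w; pose proof loop_wgt; repeat loop_step.
Qed.

Lemma metric_psub_l (U U' V : pairfun) : tangent U -> tangent U' -> tangent V ->
  metric lam w p (psub U U') V = metric lam w p U V - metric lam w p U' V.
Proof.
intros; rewrite !metric_pullback by auto using tangent_psub.
rewrite <- circle_int_minus by now apply loop_metric_integrand.
apply circle_int_ext; intros; simpl; ring.
Qed.

Lemma metric_definite (U : pairfun) : tangent U -> metric lam w p U U = 0 ->
  forall s, fst U s = 0 /\ snd U s = 0.
Proof.
intros TU; rewrite metric_pullback by assumption; intros H0 s.
assert (Hnn : forall r, 0 <= wgt p r * snd U r * snd U r + w r * fst U r * fst U r).
{ intros r; pose proof (wgt_pos r); pose proof (w_pos r).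
  rewrite !Rmult_assoc; apply Rplus_le_le_0_compat; apply Rmult_le_pos; nra. }
pose proof (circle_int_definite _ (loop_metric_integrand U U TU TU) Hnn H0 s) as Hs.
simpl in Hs; pose proof (wgt_pos s) as Hwgt; pose proof (w_pos s) as Hws.
assert (H1 : 0 <= wgt p s * (snd U s * snd U s)) by (apply Rmult_le_pos; nra).
assert (H2 : 0 <= w s * (fst U s * fst U s)) by (apply Rmult_le_pos; nra).
assert (H3 : w s * (fst U s * fst U s) = 0) by lra.
assert (H4 : wgt p s * (snd U s * snd U s) = 0) by lra.
apply Rmult_integral in H3, H4; destruct H3 as [H3|H3], H4 as [H4|H4]; try lra.
apply Rmult_integral in H3, H4; lra.
Qed.

End At_configuration.

(** Both connections reproduce the same derivative of the metric, so their difference [S] is skew in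
    its last two slots and symmetric in its first two. Although weak, the metric is definite:
    pairing [S U V] with itself shows that it vanishes pointwise. *)
Lemma levi_civita_unique (G G' : christoffel) :
  is_levi_civita lam w G -> is_levi_civita lam w G' ->
  forall p, diffeo_config p -> forall U V, tangent U -> tangent V -> G p U V = G' p U V.
Proof.
intros [HG [SG MG]] [HG' [SG' MG']] p Hp.
set (S := fun U V => psub (G p U V) (G' p U V)).
assert (TG : forall U V, tangent U -> tangent V -> tangent (G p U V)) by apply (HG p Hp).
assert (TG' : forall U V, tangent U -> tangent V -> tangent (G' p U V)) by apply (HG' p Hp).
assert (TS : forall U V, tangent U -> tangent V -> tangent (S U V)).
{ intros; apply tangent_psub; auto. }
assert (Ssym : forall U V, tangent U -> tangent V -> S U V = S V U).
{ intros; unfold S; rewrite (SG p Hp U V), (SG' p Hp U V); auto. }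
assert (Sskew : forall U V W, tangent U -> tangent V -> tangent W ->
  metric lam w p (S U V) W = - metric lam w p (S U W) V).
{ intros U V W TU TV TW; unfold S.
  rewrite !metric_psub_l by auto.
  rewrite (metric_sym p Hp (G p U W)), (metric_sym p Hp (G' p U W)) by auto.
  pose proof (is_derive_unique _ _ _ (MG p Hp U V W TU TV TW)) as H1.
  pose proof (is_derive_unique _ _ _ (MG' p Hp U V W TU TV TW)) as H2.
  rewrite H1 in H2; lra. }
(* A trilinear form symmetric in one pair of arguments and skew in another vanishes. *)
assert (S0 : forall U V W, tangent U -> tangent V -> tangent W ->
  metric lam w p (S U V) W = 0).
{ intros U V W TU TV TW.
  pose proof (Sskew U V W TU TV TW); pose proof (Sskew W U V TW TU TV).
  pose proof (Sskew V W U TV TW TU).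
  pose proof (f_equal (fun X => metric lam w p X V) (Ssym U W TU TW)).
  pose proof (f_equal (fun X => metric lam w p X U) (Ssym V W TV TW)).
  pose proof (f_equal (fun X => metric lam w p X W) (Ssym U V TU TV)).
  simpl in *; lra. }
intros U V TU TV.
pose proof (metric_definite p Hp (S U V) (TS U V TU TV) (S0 U V (S U V) TU TV (TS U V TU TV))) as H.
rewrite (surjective_pairing (G p U V)), (surjective_pairing (G' p U V)).
f_equal; apply functional_extensionality; intros s; destruct (H s) as [H1 H2];
  unfold S in H1, H2; simpl in H1, H2; lra.
Qed.

(** * Variation of the metric along a line of configurations *)

Definition dphir (p U : pairfun) (s : R) : R :=
  Derive (phi lam) (rad p s) * (- rad p s * Derive (fst U) s / Derive (fst p) s).

(** This is where [phi] originates: with r = c / a, the derivative of lam(r) a in a is lam(r) - r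
    lam'(r) = 2 phi(r). *)
Lemma is_derive_lam_line (a b c t : R) : 0 < c -> 0 < a + t * b ->
  is_derive (fun t => lam (c / (a + t * b)) * (a + t * b)) t
    (2 * phi lam (c / (a + t * b)) * b).
Proof.
intros Hc Ha.
pose proof (smooth_on_pos_ex_derive lam (c / (a + t * b)) lam_smooth
  (Rdiv_lt_0_compat _ _ Hc Ha)).
unfold phi; auto_derive.
- repeat split; auto; lra.
- unfold Rdiv; rewrite ?Rmult_1_l; change (Derive (fun x => lam x)) with (Derive lam).
  field; lra.
Qed.

Lemma is_derive_phi_line (a b c t : R) : 0 < c -> 0 < a + t * b ->
  is_derive (fun t => phi lam (c / (a + t * b))) t
    (Derive (phi lam) (c / (a + t * b)) * (- (c / (a + t * b)) * b / (a + t * b))).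
Proof.
intros Hc Ha.
pose proof (smooth_on_pos_ex_derive (phi lam) (c / (a + t * b))
  (smooth_on_pos_phi lam lam_smooth) (Rdiv_lt_0_compat _ _ Hc Ha)).
auto_derive.
- repeat split; auto; lra.
- unfold Rdiv; rewrite ?Rmult_1_l; change (Derive (fun x => phi lam x)) with (Derive (phi lam)).
  field; lra.
Qed.

Section Line.

Context (p U : pairfun) (Hp : diffeo_config p) (HU : tangent U).

Local Notation "'line' t" := (padd p (pscal t U)) (at level 10, t at level 9).

Lemma Derive_fst_line (t s : R) :
  Derive (fst (line t)) s = Derive (fst p) s + t * Derive (fst U) s.
Proof. apply Derive_line; [apply Hp | apply HU]. Qed.

Lemma line_0 : line 0 = p.
Proof.
rewrite (surjective_pairing p) at 2; unfold padd, pscal; simpl.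
f_equal; apply functional_extensionality; intros; ring.
Qed.

Lemma is_derive_wgt (s : R) :
  is_derive (fun t => wgt (line t) s) 0 (2 * phir p s * Derive (fst U) s).
Proof.
pose proof (w_pos s) as Hws; pose proof (Deta_pos p Hp s) as Ha.
apply (is_derive_ext (fun t => lam (w s / (Derive (fst p) s + t * Derive (fst U) s)) *
  (Derive (fst p) s + t * Derive (fst U) s))).
- intros t; unfold wgt, rad; now rewrite Derive_fst_line.
- pose proof (is_derive_lam_line (Derive (fst p) s) (Derive (fst U) s) (w s) 0) as H.
  rewrite Rmult_0_l, Rplus_0_r in H; now apply H.
Qed.

Lemma is_derive_phir (s : R) : is_derive (fun t => phir (line t) s) 0 (dphir p U s).
Proof.
pose proof (w_pos s) as Hws; pose proof (Deta_pos p Hp s) as Ha.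
apply (is_derive_ext (fun t => phi lam (w s / (Derive (fst p) s + t * Derive (fst U) s)))).
- intros t; unfold phir, rad; now rewrite Derive_fst_line.
- pose proof (is_derive_phi_line (Derive (fst p) s) (Derive (fst U) s) (w s) 0) as H.
  rewrite Rmult_0_l, Rplus_0_r in H; now apply H.
Qed.

Lemma loop_dphir : loop (dphir p U).
Proof.
pose proof (loop_rad p Hp) as Lr; pose proof (loop_Deta p Hp) as La.
assert (L0 : loop (fun s => Derive (phi lam) (rad p s))).
{ apply (loop_comp_pos (Derive (phi lam)) (rad p)); auto.
  - now apply smooth_on_pos_Derive, smooth_on_pos_phi.
  - now apply rad_pos. }
assert (L1 : loop (fun s => -1 * rad p s * Derive (fst U) s / Derive (fst p) s)).
{ destruct HU as [Lu _].
  repeat loop_step; now apply Deta_pos. }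
replace (dphir p U) with (fun s => Derive (phi lam) (rad p s) *
  (-1 * rad p s * Derive (fst U) s / Derive (fst p) s)).
- now apply loop_mult.
- apply functional_extensionality; intros s; unfold dphir, Rdiv; ring.
Qed.

Lemma Derive_phir (q : pairfun) (s : R) : diffeo_config q ->
  Derive (phir q) s = Derive (phi lam) (rad q s) *
    ((Derive w s * Derive (fst q) s - w s * Derive (Derive (fst q)) s) / Derive (fst q) s ^ 2).
Proof.
intros Hq; apply is_derive_unique.
pose proof (smooth_on_pos_ex_derive (phi lam) (rad q s)
  (smooth_on_pos_phi lam lam_smooth) (rad_pos q Hq s)) as H1.
pose proof (smooth_ex_derive (Derive (fst q)) s (proj1 (loop_Deta q Hq))) as H2.
pose proof (smooth_ex_derive w s (proj1 loop_w)) as H3.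
pose proof (Deta_pos q Hq s) as Ha.
unfold phir, rad in *; auto_derive.
- repeat split; auto; lra.
- change (Derive (fun x => phi lam x)) with (Derive (phi lam)).
  change (Derive (fun x => Derive (fst q) x)) with (Derive (Derive (fst q))).
  change (Derive (fun x => w x)) with (Derive w).
  unfold Rdiv; field; lra.
Qed.

(** The first component of [gamma] contains the derivative of q along N, so its variation needs the
    derivatives in [t] and [s] to commute. Both orders are computed in closed form and compared. *)
Lemma is_derive_Derive_phir (s : R) :
  is_derive (fun t => Derive (phir (line t)) s) 0 (Derive (dphir p U) s).
Proof.
set (a := Derive (fst p)); set (b := Derive (fst U)).
pose proof (w_pos s) as Hws; pose proof (Deta_pos p Hp s) as Ha; fold a in Ha.
pose proof (rad_pos p Hp s) as Hr.
pose proof (smooth_on_pos_ex_derive (Derive (phi lam)) (rad p s)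
  (smooth_on_pos_Derive _ (smooth_on_pos_phi lam lam_smooth)) Hr) as H1.
pose proof (loop_Deta p Hp) as La; fold a in La.
pose proof (loop_Derive _ (proj1 HU)) as Lb; fold b in Lb.
pose proof (smooth_ex_derive _ s (proj1 La)) as Ea.
pose proof (smooth_ex_derive _ s (proj1 Lb)) as Eb.
pose proof (smooth_ex_derive _ s (proj1 loop_w)) as Ew.
apply (is_derive_ext_loc (fun t => Derive (phi lam) (w s / (a s + t * b s)) *
  ((Derive w s * (a s + t * b s) - w s * (Derive a s + t * Derive b s)) / (a s + t * b s) ^ 2))).
- generalize (diffeo_config_line p U Hp HU); apply filter_imp; intros t Ht.
  rewrite (Derive_phir _ s Ht); unfold rad; rewrite Derive_fst_line; fold a b.
  rewrite (Derive_ext _ _ s (Derive_fst_line t)), Derive_line; auto; [apply La | apply Lb].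
- assert (H : is_derive (dphir p U) s
    (Derive (Derive (phi lam)) (rad p s) * ((Derive w s * a s - w s * Derive a s) / (a s)^2) *
      (- rad p s * b s / a s)
     + Derive (phi lam) (rad p s) * (- ((Derive w s * a s - w s * Derive a s) / (a s)^2) * b s / a s
       - rad p s * (Derive b s * a s - b s * Derive a s) / (a s)^2))).
  { unfold dphir, rad in *; fold a b in H1 |- *; auto_derive.
    - repeat split; auto; lra.
    - change (Derive (fun x => Derive (phi lam) x)) with (Derive (Derive (phi lam))).
      change (Derive (fun x => a x)) with (Derive a).
      change (Derive (fun x => b x)) with (Derive b).
      change (Derive (fun x => w x)) with (Derive w).
      unfold Rdiv; field; lra. }
  rewrite (is_derive_unique _ _ _ H); unfold rad in *; fold a in H1 |- *.
  auto_derive; rewrite ?Rmult_0_l, ?Rplus_0_r in *.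
  + repeat split; auto; try lra; rewrite Rmult_1_r; apply Rmult_integral_contrapositive; lra.
  + change (Derive (fun x => Derive (phi lam) x)) with (Derive (Derive (phi lam))).
    unfold Rdiv; field; lra.
Qed.

(** On M the inverse of the diffeomorphism would vary with [t]. On N the vectors [V], [W] stay fixed
    and only the weight L moves, so one can differentiate under the integral. *)
Lemma is_derive_metric (V W : pairfun) : tangent V -> tangent W ->
  is_derive (fun t => metric lam w (line t) V W) 0
    (circle_int (fun s => 2 * phir p s * Derive (fst U) s * snd V s * snd W s)).
Proof.
intros TV TW.
set (a := Derive (fst p)); set (b := Derive (fst U)).
pose (f := fun t s => lam (w s / (a s + t * b s)) * (a s + t * b s) * snd V s * snd W s
  + w s * fst V s * fst W s).
pose proof (diffeo_config_line p U Hp HU) as Hline.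
assert (Hpos : locally 0 (fun t => forall s, 0 < a s + t * b s)).
{ revert Hline; apply filter_imp; intros t Ht s.
  pose proof (Deta_pos _ Ht s) as H; now rewrite Derive_fst_line in H. }
assert (Df : forall t s, 0 < a s + t * b s -> is_derive (fun t => f t s) t
  (2 * phi lam (w s / (a s + t * b s)) * b s * snd V s * snd W s)).
{ intros t s H; unfold f.
  apply (is_derive_ext (fun t => snd V s * snd W s * (lam (w s / (a s + t * b s)) * (a s + t * b s))
    + w s * fst V s * fst W s)); [intros r; simpl; ring|].
  replace (2 * phi lam (w s / (a s + t * b s)) * b s * snd V s * snd W s) with
    (snd V s * snd W s * (2 * phi lam (w s / (a s + t * b s)) * b s) + 0) by ring.
  apply (is_derive_plus (V := R_NormedModule)); [|apply (is_derive_const (V := R_NormedModule))].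
  apply is_derive_scal, is_derive_lam_line; [now apply w_pos | assumption]. }
apply (is_derive_ext_loc (fun t => RInt (fun s => f t s) 0 (2 * PI))).
{ revert Hline; apply filter_imp; intros t Ht.
  rewrite (metric_pullback) by assumption.
  apply circle_int_ext; intros s; unfold f, wgt, rad; now rewrite Derive_fst_line. }
replace (circle_int _) with (RInt (fun s => Derive (fun t => f t s) 0) 0 (2 * PI)).
2: { apply circle_int_ext; intros s.
  pose proof (Deta_pos p Hp s) as Ha.
  etransitivity; [apply is_derive_unique, Df; fold a in Ha; lra|].
  unfold phir, rad; now rewrite Rmult_0_l, Rplus_0_r. }
apply is_derive_RInt_param.
- revert Hpos; apply filter_imp; intros t Ht s _; eexists; now apply Df.
(* Joint continuity in [(t, s)] is checked on the closed formula. It agrees with the derivative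
   wherever the slope is positive, hence for small [t] and all [s] at once. *)
- intros s _; destruct Hpos as [d Hd].
  apply (continuity_2d_pt_ext_loc
    (fun t s => 2 * phi lam (w s / (a s + t * b s)) * b s * snd V s * snd W s)).
  { exists d; intros t r Ht _; symmetry; apply is_derive_unique, Df, Hd, Ht. }
  apply continuity_2d_pt_filterlim.
  pose proof (Deta_pos p Hp s) as Ha; fold a in Ha.
  pose proof (w_pos s) as Hws.
  assert (C2 : forall g, loop g -> continuous (fun z : R * R => g (snd z)) (0, s)).
  { intros g Lg; apply (continuous_comp snd g); [apply continuous_snd | now apply loop_continuous]. }
  pose proof (C2 a (loop_Deta p Hp)) as Ca.
  pose proof (C2 b (loop_Derive _ (proj1 HU))) as Cb.
  pose proof (C2 w loop_w) as Cw.
  assert (Cd : continuous (fun z : R * R => a (snd z) + fst z * b (snd z)) (0, s)).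
  { apply (continuous_plus (V := R_NormedModule)); [exact Ca|].
    apply (continuous_mult (K := R_AbsRing)); [apply continuous_fst | exact Cb]. }
  assert (Cr : continuous (fun z : R * R => w (snd z) / (a (snd z) + fst z * b (snd z))) (0, s)).
  { apply (continuous_mult (K := R_AbsRing)); [exact Cw|].
    apply (continuous_comp (fun z : R * R => a (snd z) + fst z * b (snd z)) Rinv); [exact Cd|].
    apply (ex_derive_continuous (V := R_NormedModule)); simpl; auto_derive; lra. }
  assert (Cphi : continuous (fun z : R * R => phi lam (w (snd z) / (a (snd z) + fst z * b (snd z)))) (0, s)).
  { apply (continuous_comp _ (phi lam) _ Cr); simpl.
    apply (ex_derive_continuous (V := R_NormedModule)).
    apply smooth_on_pos_ex_derive; [now apply smooth_on_pos_phi|].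
    rewrite Rmult_0_l, Rplus_0_r; now apply Rdiv_lt_0_compat. }
  pose proof (C2 _ (proj2 TV)) as Cv; pose proof (C2 _ (proj2 TW)) as Cx.
  pose proof (fun g h Cg Ch => continuous_mult (K := R_AbsRing) g h (0, s) Cg Ch) as Cm.
  exact (Cm _ _ (Cm _ _ (Cm _ _ (Cm _ _ (continuous_const 2 _) Cphi) Cb) Cv) Cx).
- revert Hline; apply filter_imp; intros t Ht.
  apply (ex_RInt_ext (fun s => wgt (line t) s * snd V s * snd W s + w s * fst V s * fst W s)).
  { intros s _; unfold f, wgt, rad; now rewrite Derive_fst_line. }
  apply loop_ex_RInt, loop_metric_integrand; auto.
Qed.

End Line.

(** * The Christoffel map and its derivative in the configuration *)

Definition gamma (p U V : pairfun) : pairfun :=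
  (fun s => Derive (fun r => phir p r * snd U r * snd V r) s / w s,
   fun s => phir p s * (Derive (fst U) s * snd V s + Derive (fst V) s * snd U s) / wgt p s).

(** The variation of [gamma p V W] in the direction [U]. The coefficient in the second component is
    the variation of q / L, where L varies by 2 q u'. *)
Definition dgamma (p U V W : pairfun) : pairfun :=
  (fun s => Derive (fun r => dphir p U r * snd V r * snd W r) s / w s,
   fun s => (dphir p U s / wgt p s - 2 * phir p s ^ 2 * Derive (fst U) s / wgt p s ^ 2) *
     (Derive (fst V) s * snd W s + Derive (fst W) s * snd V s)).

Lemma Derive_mult3 (f g h : R -> R) (s : R) : loop f -> loop g -> loop h ->
  Derive (fun r => f r * g r * h r) s =
  Derive f s * (g s * h s) + f s * (Derive g s * h s + g s * Derive h s).
Proof.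
intros Lf Lg Lh.
rewrite Derive_mult, Derive_mult; try (apply smooth_ex_derive; first [apply Lf|apply Lg|apply Lh]).
- ring.
- now apply smooth_ex_derive, (loop_mult f g).
Qed.

Lemma Derive_loop_plus (f g : R -> R) (s : R) : loop f -> loop g ->
  Derive (fun r => f r + g r) s = Derive f s + Derive g s.
Proof. intros [Sf _] [Sg _]; apply Derive_plus; now apply smooth_ex_derive. Qed.

Lemma Derive_loop_minus (f g : R -> R) (s : R) : loop f -> loop g ->
  Derive (fun r => f r - g r) s = Derive f s - Derive g s.
Proof. intros [Sf _] [Sg _]; apply Derive_minus; now apply smooth_ex_derive. Qed.

Lemma Derive_loop_mult (f g : R -> R) (s : R) : loop f -> loop g ->
  Derive (fun r => f r * g r) s = Derive f s * g s + f s * Derive g s.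
Proof. intros [Sf _] [Sg _]; apply Derive_mult; now apply smooth_ex_derive. Qed.

Section At_configuration.

Context (p : pairfun) (Hp : diffeo_config p).

Lemma tangent_gamma (U V : pairfun) : tangent U -> tangent V -> tangent (gamma p U V).
Proof.
intros [Lu Lf] [Lv Lg].
change (loop (fst U)) in Lu; change (loop (snd U)) in Lf.
change (loop (fst V)) in Lv; change (loop (snd V)) in Lg.
pose proof loop_w; pose proof (loop_wgt p Hp).
pose proof (loop_phir p Hp).
split; [change (loop (fst (gamma p U V))) | change (loop (snd (gamma p U V)))]; simpl;
  repeat loop_step.
- apply Hw.
- now apply wgt_pos.
Qed.

Lemma tangent_dgamma (U V W : pairfun) : tangent U -> tangent V -> tangent W ->
  tangent (dgamma p U V W).
Proof.
intros TU [Lv Lg] [Lx Lk].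
pose proof (loop_dphir p U Hp TU).
destruct TU as [Lu Lf].
change (loop (fst U)) in Lu; change (loop (snd U)) in Lf.
change (loop (fst V)) in Lv; change (loop (snd V)) in Lg.
change (loop (fst W)) in Lx; change (loop (snd W)) in Lk.
pose proof loop_w; pose proof (loop_wgt p Hp).
pose proof (loop_phir p Hp).
pose proof (wgt_pos p Hp).
split; [change (loop (fst (dgamma p U V W))) | change (loop (snd (dgamma p U V W)))]; simpl;
  repeat loop_step; auto.
- apply Hw.
- intros s; rewrite Rmult_1_r; now apply Rmult_lt_0_compat.
Qed.

Lemma gamma_linear_l (a : R) (U U' V : pairfun) : tangent U -> tangent U' -> tangent V ->
  gamma p (padd (pscal a U) U') V = padd (pscal a (gamma p U V)) (gamma p U' V).
Proof.
intros [Lu Lf] [Lu' Lf'] [Lv Lg].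
pose proof (loop_phir p Hp) as Lq.
unfold gamma, padd, pscal; simpl; f_equal; apply functional_extensionality; intros s.
- rewrite !Derive_mult3; auto; [|repeat loop_step].
  rewrite Derive_plus, Derive_scal.
  + unfold Rdiv; ring.
  + now apply ex_derive_scal, smooth_ex_derive, Lf.
  + apply smooth_ex_derive, Lf'.
- rewrite Derive_plus, Derive_scal.
  + unfold Rdiv; ring.
  + now apply ex_derive_scal, smooth_ex_derive, Lu.
  + apply smooth_ex_derive, Lu'.
Qed.

Lemma gamma_sym (U V : pairfun) : gamma p U V = gamma p V U.
Proof.
unfold gamma; f_equal; apply functional_extensionality; intros s.
- f_equal; apply Derive_ext; intros r; ring.
- unfold Rdiv; ring.
Qed.

Lemma is_derive_gamma (U V W : pairfun) (s : R) : tangent U -> tangent V -> tangent W ->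
  is_derive (fun t => fst (gamma (padd p (pscal t U)) V W) s) 0 (fst (dgamma p U V W) s) /\
  is_derive (fun t => snd (gamma (padd p (pscal t U)) V W) s) 0 (snd (dgamma p U V W) s).
Proof.
intros TU [Lv Lg] [Lx Lk].
pose proof (is_derive_phir p U Hp TU s) as Hq.
pose proof (is_derive_wgt p U Hp TU s) as HL.
pose proof (line_0 p U) as H0.
split; simpl.
- apply (is_derive_ext_loc (fun t =>
    (Derive (phir (padd p (pscal t U))) s * (snd V s * snd W s)
     + phir (padd p (pscal t U)) s * (Derive (snd V) s * snd W s + snd V s * Derive (snd W) s))
    * / w s)).
  { generalize (diffeo_config_line p U Hp TU); apply filter_imp; intros t Ht.
    rewrite Derive_mult3; auto; now apply loop_phir. }
  rewrite Derive_mult3; auto; [|now apply loop_dphir].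
  pose proof (is_derive_Derive_phir p U Hp TU s) as Hq'.
  evar_last.
  + apply (is_derive_mult (K := R_AbsRing)); [|apply (is_derive_const (V := R_NormedModule))|apply Rmult_comm].
    apply (is_derive_plus (V := R_NormedModule));
    (apply (is_derive_mult (K := R_AbsRing)); [eassumption|apply (is_derive_const (V := R_NormedModule))|apply Rmult_comm]).
  + unfold plus, mult, zero; simpl; unfold Rdiv; ring.
- pose proof (wgt_pos p Hp s) as Hpos.
  evar_last.
  + apply is_derive_div; [|exact HL|rewrite H0; lra].
    apply (is_derive_mult (K := R_AbsRing)); [exact Hq|apply (is_derive_const (V := R_NormedModule))|apply Rmult_comm].
  + cbv beta; rewrite H0; unfold plus, mult, zero; simpl; field; lra.
Qed.

Lemma metric_gamma (U V W : pairfun) : tangent U -> tangent V -> tangent W ->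
  metric lam w p (gamma p U V) W + metric lam w p V (gamma p U W) =
  circle_int (fun s => 2 * phir p s * Derive (fst U) s * snd V s * snd W s).
Proof.
intros TU TV TW.
pose proof (tangent_gamma U V TU TV) as TUV; pose proof (tangent_gamma U W TU TW) as TUW.
rewrite !metric_pullback by assumption.
rewrite <- circle_int_plus by now apply loop_metric_integrand.
destruct TU as [Lu Lf], TV as [Lv Lg], TW as [Lh Lk].
change (loop (fst U)) in Lu; change (loop (snd U)) in Lf.
change (loop (fst V)) in Lv; change (loop (snd V)) in Lg.
change (loop (fst W)) in Lh; change (loop (snd W)) in Lk.
pose proof (loop_phir p Hp) as Lq.
(* Write U = (u,f), V = (v,g), W = (h,k). The first components contribute (q f g)' h + (q f k)' v
   and the second ones q f g h' + q f k v' besides the wanted 2 q u' g k; together the extra terms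
   are the exact derivative of [B]. *)
set (B := fun s => phir p s * snd U s * (snd V s * fst W s + snd W s * fst V s)).
assert (LB : loop B) by (unfold B; repeat loop_step).
rewrite <- (Rplus_0_r (circle_int (fun s => 2 * _ * _ * _ * _))), <- (circle_int_Derive B LB).
rewrite <- circle_int_plus; [|repeat loop_step|now apply loop_Derive].
apply circle_int_ext; intros s; simpl; unfold B.
rewrite !Derive_mult3, Derive_plus, !Derive_mult; auto;
  try (apply smooth_ex_derive; first [apply Lg|apply Lh|apply Lk|apply Lv]);
  try (repeat loop_step);
  try (apply smooth_ex_derive; apply loop_mult; assumption).
pose proof (w_pos s); pose proof (wgt_pos p Hp s).
field; lra.
Qed.

End At_configuration.

Lemma is_levi_civita_gamma : is_levi_civita lam w gamma.
Proof.
split; [|split].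
- intros p Hp; split; [|split; [|split]].
  + now apply tangent_gamma.
  + now apply gamma_linear_l.
  + intros; rewrite !(gamma_sym p U); now apply gamma_linear_l.
  + intros U V W TU TV TW s; destruct (is_derive_gamma p Hp U V W s TU TV TW) as [H1 H2].
    split; eexists; eassumption.
- intros p _ U V _ _; apply gamma_sym.
- intros p Hp U V W TU TV TW; rewrite metric_gamma by assumption.
  now apply is_derive_metric.
Qed.

(** [gamma] serves twice: as a witness it makes the epsilon satisfy its specification, and by
    uniqueness it then gives the epsilon's values. *)
Lemma levi_civita_gamma (p U V : pairfun) : diffeo_config p -> tangent U -> tangent V ->
  levi_civita lam w p U V = gamma p U V.
Proof.
intros; apply (levi_civita_unique); auto.
- exact (epsilon_spec _ (is_levi_civita lam w) (ex_intro _ gamma is_levi_civita_gamma)).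
- apply is_levi_civita_gamma.
Qed.

(** * Curvature in the affine coordinate, and the sectional curvature as an integral *)

Definition pzero : pairfun := (fun _ => 0, fun _ => 0).

Lemma padd_0_l (U : pairfun) : padd pzero U = U.
Proof.
rewrite (surjective_pairing U); unfold padd, pzero; simpl.
f_equal; apply functional_extensionality; intros; ring.
Qed.

Lemma ddir_const (U V p : pairfun) : ddir (fun _ => U) p V = pzero.
Proof. unfold ddir, pzero; f_equal; apply functional_extensionality; intros; apply Derive_const. Qed.

Lemma nabla_const_r (G : christoffel) (X : vfield) (V : pairfun) :
  nabla G X (fun _ => V) = fun p => G p (X p) V.
Proof.
apply functional_extensionality; intros p; unfold nabla.
now rewrite ddir_const, padd_0_l.
Qed.

Lemma bracket_const (U V : pairfun) : bracket (fun _ => U) (fun _ => V) = fun _ => pzero.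
Proof.
apply functional_extensionality; intros p; unfold bracket, psub.
rewrite !ddir_const, padd_0_l; unfold pscal, pzero; simpl.
f_equal; apply functional_extensionality; intros; ring.
Qed.

(** Equality with [gamma] at [p] alone would say nothing about a derivative; it holds at every
    configuration of the line for small [t]. *)
Lemma ddir_levi_civita (p U V W : pairfun) : diffeo_config p ->
  tangent U -> tangent V -> tangent W ->
  ddir (fun p => levi_civita lam w p V W) p U = dgamma p U V W.
Proof.
intros Hp TU TV TW; rewrite (surjective_pairing (dgamma p U V W)).
unfold ddir; f_equal; apply functional_extensionality; intros s;
  apply is_derive_unique; destruct (is_derive_gamma p Hp U V W s TU TV TW) as [H1 H2];
  eapply is_derive_ext_loc; try eassumption;
  generalize (diffeo_config_line p U Hp TU); apply filter_imp; intros t Ht;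
  now rewrite levi_civita_gamma.
Qed.

Lemma riemann_gamma (p U V W : pairfun) : diffeo_config p ->
  tangent U -> tangent V -> tangent W ->
  riemann lam w p U V W =
  psub (padd (dgamma p U V W) (gamma p U (gamma p V W)))
       (padd (dgamma p V U W) (gamma p V (gamma p U W))).
Proof.
intros Hp TU TV TW.
assert (T0 : tangent pzero) by (split; exact (loop_const 0)).
(* Constant fields commute, so this is the bracket term of the curvature. *)
assert (G0 : gamma p pzero W = pzero).
{ unfold gamma, pzero; simpl; f_equal; apply functional_extensionality; intros s.
  - rewrite (Derive_ext _ (fun _ => 0)) by (intros; ring); rewrite Derive_const.
    unfold Rdiv; ring.
  - rewrite Derive_const; unfold Rdiv; ring. }
unfold riemann, curvature, curvature_field.
rewrite bracket_const, !nabla_const_r, levi_civita_gamma, G0 by assumption.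
unfold nabla; rewrite !ddir_levi_civita by assumption.
rewrite !(levi_civita_gamma p _ W), !levi_civita_gamma by auto using tangent_gamma.
unfold psub at 1, padd at 1, pscal at 1; simpl.
match goal with |- _ = ?X => rewrite (surjective_pairing X) end.
f_equal; apply functional_extensionality; intros; simpl; ring.
Qed.

(** The term with phi' is -dq/da, since rho = w / a has derivative -rho / a. The squares come from
    (u' g + v' f)^2 - 4 u' f v' g = (u' g - v' f)^2 and (q f g)'^2 - (q f^2)' (q g^2)' = q^2 (f' g -
    f g')^2; in the latter every q' cancels. *)
Definition curv_density (p U V : pairfun) (s : R) : R :=
  (phir p s ^ 2 / wgt p s + Derive (phi lam) (rad p s) * rad p s / Derive (fst p) s) *
    (Derive (fst U) s * snd V s - Derive (fst V) s * snd U s) ^ 2 +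
  phir p s ^ 2 * (Derive (snd U) s * snd V s - snd U s * Derive (snd V) s) ^ 2 / w s.

Lemma loop_curv_density (p U V : pairfun) : diffeo_config p -> tangent U -> tangent V ->
  loop (curv_density p U V).
Proof.
intros Hp [Lu Lf] [Lv Lg].
change (loop (fst U)) in Lu; change (loop (snd U)) in Lf.
change (loop (fst V)) in Lv; change (loop (snd V)) in Lg.
pose proof (loop_phir p Hp).
pose proof (loop_wgt p Hp).
pose proof loop_w.
pose proof (loop_Deta p Hp).
pose proof (loop_rad p Hp).
assert (loop (fun s => Derive (phi lam) (rad p s))).
{ apply (loop_comp_pos (Derive (phi lam)) (rad p)); auto.
  - now apply smooth_on_pos_Derive, smooth_on_pos_phi.
  - now apply rad_pos. }
unfold curv_density; simpl; repeat loop_step.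
- now apply wgt_pos.
- now apply Deta_pos.
- apply Hw.
Qed.

Lemma sectional_curvature (p U V : pairfun) : diffeo_config p -> tangent U -> tangent V ->
  metric lam w p (riemann lam w p U V V) U = circle_int (curv_density p U V).
Proof.
intros Hp TU TV.
pose proof (loop_curv_density p U V Hp TU TV) as LK.
pose proof (tangent_gamma p Hp U V TU TV) as TUV; pose proof (tangent_gamma p Hp V V TV TV) as TVV.
assert (TR : tangent (riemann lam w p U V V)).
{ rewrite riemann_gamma by assumption.
  apply tangent_psub; apply tangent_padd; auto using tangent_gamma, tangent_dgamma. }
rewrite metric_pullback by assumption.
rewrite riemann_gamma by assumption.
pose proof (loop_phir p Hp) as Lq.
pose proof (loop_wgt p Hp) as LL.
pose proof loop_w as Lw.
pose proof (loop_Deta p Hp) as La.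
pose proof (loop_rad p Hp) as Lr.
pose proof (loop_dphir p U Hp TU) as LdU.
pose proof (loop_dphir p V Hp TV) as LdV.
destruct TU as [Lu Lf], TV as [Lv Lg], TUV as [LP3 LG], TVV as [LP2 LH].
set (P2 := fst (gamma p V V)) in *; set (P3 := fst (gamma p U V)) in *.
set (H := snd (gamma p V V)) in *; set (G := snd (gamma p U V)) in *.
change (loop (fst U)) in Lu; change (loop (snd U)) in Lf.
change (loop (fst V)) in Lv; change (loop (snd V)) in Lg.
change (loop P2) in LP2; change (loop P3) in LP3; change (loop H) in LH; change (loop G) in LG.
(* All four terms in the first component of the curvature are derivatives divided by [w]; [A] is
   their common primitive. Pairing with w u and integrating by parts leaves -u' A. *)
set (A := fun s => dphir p U s * snd V s * snd V s + phir p s * snd U s * H s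
  - dphir p V s * snd U s * snd V s - phir p s * snd V s * G s).
(* The two integrands differ by [B'], which collects the boundary terms of the
   integrations by parts. *)
set (B := fun s => fst U s * A s
  + phir p s * snd U s * (snd U s * P2 s - snd V s * P3 s)).
assert (LA : loop A) by (unfold A; repeat loop_step).
assert (LB : loop B) by (unfold B; repeat loop_step).
rewrite <- (Rplus_0_r (circle_int (curv_density p U V))), <- (circle_int_Derive B LB).
rewrite <- circle_int_plus by (assumption || now apply loop_Derive).
apply circle_int_ext; intros s.
match goal with |- wgt p s * snd ?R s * _ + w s * fst ?R s * _ = _ =>
  assert (E1 : fst R s = Derive A s / w s);
  [|assert (E2 : snd R s =
    (dphir p U s / wgt p s - 2 * phir p s ^ 2 * Derive (fst U) s / wgt p s ^ 2) *
      (Derive (fst V) s * snd V s + Derive (fst V) s * snd V s)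
    + phir p s * (Derive (fst U) s * H s + Derive P2 s * snd U s) / wgt p s
    + -1 * ((dphir p V s / wgt p s - 2 * phir p s ^ 2 * Derive (fst V) s / wgt p s ^ 2) *
      (Derive (fst U) s * snd V s + Derive (fst V) s * snd U s)
    + phir p s * (Derive (fst V) s * G s + Derive P3 s * snd V s) / wgt p s)) by reflexivity]
end.
{ change (Derive (fun r => dphir p U r * snd V r * snd V r) s / w s
    + Derive (fun r => phir p r * snd U r * H r) s / w s
    + -1 * (Derive (fun r => dphir p V r * snd U r * snd V r) s / w s
    + Derive (fun r => phir p r * snd V r * G r) s / w s) = Derive A s / w s).
  unfold A; rewrite 2 Derive_loop_minus, Derive_loop_plus by repeat loop_step.
  unfold Rdiv; ring. }
rewrite E1, E2.
assert (EB : Derive B s = Derive (fst U) s * A s + fst U s * Derive A s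
  + (Derive (phir p) s * snd U s + phir p s * Derive (snd U) s) * (snd U s * P2 s - snd V s * P3 s)
  + phir p s * snd U s * (Derive (snd U) s * P2 s + snd U s * Derive P2 s
     - (Derive (snd V) s * P3 s + snd V s * Derive P3 s))).
{ unfold B; rewrite Derive_loop_plus, !Derive_loop_mult, Derive_loop_minus,
    !Derive_loop_mult by repeat loop_step; ring. }
rewrite EB; unfold A, curv_density.
assert (EP2 : P2 s = (Derive (phir p) s * (snd V s * snd V s)
  + phir p s * (Derive (snd V) s * snd V s + snd V s * Derive (snd V) s)) / w s).
{ unfold P2; simpl; now rewrite Derive_mult3. }
assert (EP3 : P3 s = (Derive (phir p) s * (snd U s * snd V s)
  + phir p s * (Derive (snd U) s * snd V s + snd U s * Derive (snd V) s)) / w s).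
{ unfold P3; simpl; now rewrite Derive_mult3. }
assert (EH : H s = phir p s * (Derive (fst V) s * snd V s + Derive (fst V) s * snd V s) / wgt p s)
  by reflexivity.
assert (EG : G s = phir p s * (Derive (fst U) s * snd V s + Derive (fst V) s * snd U s) / wgt p s)
  by reflexivity.
rewrite EP2, EP3, EH, EG; unfold dphir.
pose proof (w_pos s); pose proof (wgt_pos p Hp s).
pose proof (Deta_pos p Hp s).
clear - H0 H1 H2.
(* The derivatives of [A], [P2] and [P3] enter linearly as atoms and cancel against those in B'.
   What remains is rational in the first derivatives of the data and in q', which drops out. *)
field; repeat split; lra.
Qed.

Lemma curv_density_ge0
  (Hphi : forall x, 0 < x -> x * Derive (phi lam) x + (phi lam x) ^ 2 / lam x >= 0)
  (p U V : pairfun) (s : R) : diffeo_config p -> 0 <= curv_density p U V s.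
Proof.
intros Hp; unfold curv_density, phir.
pose proof (rad_pos p Hp s) as Hr; pose proof (Deta_pos p Hp s) as Ha.
pose proof (w_pos s) as Hws; pose proof (lam_pos _ Hr) as Hl.
specialize (Hphi _ Hr).
apply Rplus_le_le_0_compat.
- apply Rmult_le_pos; [|apply pow2_ge_0].
  replace (_ + _) with ((rad p s * Derive (phi lam) (rad p s)
    + phi lam (rad p s) ^ 2 / lam (rad p s)) / Derive (fst p) s)
    by (unfold wgt; field; lra).
  apply Rdiv_le_0_compat; lra.
- apply Rdiv_le_0_compat; [|assumption].
  apply Rmult_le_pos; apply pow2_ge_0.
Qed.

End Metric.

Theorem corollary3p8 (lam w : R -> R)
  (Hlam_smooth : smooth_on_pos lam)
  (Hlam_pos : forall x : R, 0 < x -> 0 < lam x)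
  (Hw : volume_form w)
  (Hphi : forall x : R, 0 < x ->
     x * Derive (phi lam) x + (phi lam x) ^ 2 / lam x >= 0)
  (p : pairfun) (Hp : diffeo_config p)
  (U V : pairfun) (HU : tangent U) (HV : tangent V) :
  metric lam w p (riemann lam w p U V V) U >= 0.
Proof.
rewrite sectional_curvature by assumption.
apply Rle_ge, circle_int_ge0.
- now apply loop_curv_density.
- intros s; now apply curv_density_ge0.
Qed.
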